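(* Let $\mathcal{I}$ be an ideal on $\omega$. Then $\mathcal{I}$ is Egorov if and only if for every sequence $(X_n)_{n\in\omega}$ of Lebesgue measurable subsets of $[0,1]$ such that $(\chi_{X_n})_{n\in\omega}$ is $\mathcal{I}$-pointwise convergent to $0$ there is a Lebesgue measurable set $M\subseteq[0,1]$ with $\lambda(M)\le\frac12$ and $\{n\in\omega: X_n\not\subseteq M\}\in\mathcal{I}$.
   Context: An ideal on $\omega$ is a family $\mathcal{I}\subseteq\mathcal{P}(\omega)$ closed under finite unions and subsets, containing all finite sets, with $\omega\notin\mathcal{I}$. $\lambda$ is Lebesgue measure and $\chi_A$ the characteristic function of $A\subseteq[0,1]$. A sequence $(f_n)$ of real functions on $Y$ is $\mathcal{I}$-pointwise convergent to $f$ if $\{n:|f_n(y)-f(y)|\ge\varepsilon\}\in\mathcal{I}$ for all $y\in Y$, $\varepsilon>0$; $\mathcal{I}$-uniformly convergent to $f$ if $\{n:\exists y\in Y\,|f_n(y)-f(y)|\ge\varepsilon\}\in\mathcal{I}$ for all $\varepsilon>0$. $\mathcal{I}$ is Egorov if for every sequence of Lebesgue measurable $f_n:[0,1]\to\mathbb{R}$ $\mathcal{I}$-pointwise convergent to a Lebesgue measurable $f$ and every $\eta>0$ there is a measurable $M\subseteq[0,1]$ with $\lambda([0,1]\setminus M)<\eta$ and $(f_n\restriction M)$ $\mathcal{I}$-uniformly convergent to $f\restriction M$. *)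

(* Defs.v *)
From HB Require Import structures.
From mathcomp Require Import all_boot all_order all_algebra.
From mathcomp Require Import all_classical all_reals all_analysis.
Import Order.TTheory GRing.Theory Num.Theory.
Import numFieldNormedType.Exports.

Set Implicit Arguments.
Unset Strict Implicit.
Unset Printing Implicit Defensive.

Local Open Scope classical_set_scope.
Local Open Scope ring_scope.

Record is_ideal (I : set (set nat)) : Prop := IsIdeal {
  idealU : forall A B, I A -> I B -> I (A `|` B) ;
  idealS : forall A B, A `<=` B -> I B -> I A ;
  ideal_finite : forall A, finite_set A -> I A ;
  ideal_proper : ~ I setT }.

(* R with the completed (Caratheodory) sigma-algebra instead of the Borel one:
   its measurable sets are the Lebesgue measurable sets, and it is the domain
   type of completed_lebesgue_measure *)
Notation lebesgueType R := (caratheodory_type (@wlength R idfun)^*%mu).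

Definition lebesgue_measurable (R : realType) (A : set R) : Prop :=
  measurable (A : set (lebesgueType R)).

(* the target R carries its Borel sigma-algebra *)
Definition lebesgue_measurable_fun (R : realType) (D : set R) (f : R -> R) :
    Prop :=
  measurable_fun (D : set (lebesgueType R)) (f : lebesgueType R -> R).

Definition ideal_pointwise_cvg (R : realType) (T : Type) (I : set (set nat))
    (Y : set T) (f_ : nat -> T -> R) (f : T -> R) : Prop :=
  forall y (eps : R), Y y -> 0 < eps ->
    I [set n | eps <= `|f_ n y - f y|].

Definition ideal_uniform_cvg (R : realType) (T : Type) (I : set (set nat))
    (Y : set T) (f_ : nat -> T -> R) (f : T -> R) : Prop :=
  forall eps : R, 0 < eps ->
    I [set n | exists2 y, Y y & eps <= `|f_ n y - f y|].

(* functions on [0, 1] are total functions on R of which only the restriction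
   to [0, 1] matters *)
Definition egorov_ideal (R : realType) (I : set (set nat)) : Prop :=
  forall (f_ : nat -> R -> R) (f : R -> R),
    (forall n, lebesgue_measurable_fun `[0, 1] (f_ n)) ->
    lebesgue_measurable_fun `[0, 1] f ->
    ideal_pointwise_cvg I `[0, 1] f_ f ->
    forall eta : R, 0 < eta ->
      exists M : set R,
        [/\ lebesgue_measurable M, M `<=` `[0, 1],
            (completed_lebesgue_measure (`[0%R, 1%R] `\` M) < eta%:E)%E &
            ideal_uniform_cvg I M f_ f].

(* Main.v *)
Require Import Defs.
From mathcomp Require Import all_boot all_order all_algebra.
From mathcomp Require Import all_classical all_reals all_analysis.
From mathcomp Require Import measurable_realfun ring lra.
Import Order.TTheory GRing.Theory Num.Theory.
Import numFieldNormedType.Exports.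

Local Open Scope classical_set_scope.
Local Open Scope ring_scope.

(* For sets X_n with indicators I-converging to 0, consider the unions of the
   X_n over n in F, where F ranges over the dual filter of I.

   If the capturing condition holds, then for every half-open interval J some F
   makes the part of the union inside J of measure at most |J|/2: blow J up to
   ]0, 1] affinely and capture the images of the X_n in a set of measure 1/2.
   Cover the union over a given F by intervals of total length less than c and
   apply this to finitely many of them, the remaining ones having total length
   less than c/4: the union over some other F then has measure less than 3c/4.
   Iterating, some F makes the union arbitrarily small.  Applied to the sets
   where |f_n - f| >= 1/(k+1), with bound eta/2^(k+2), this yields the Egorov
   property. *)

Local Notation leb R := ((@wlength R idfun)^*)%mu.
Local Notation affine a l := (fun x => a + l * x)%R.

Lemma outer_lebesgue_ge0 (R : realType) (A : set R) : (0 <= leb R A)%E.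
Proof. by rewrite outer_measure_ge0. Qed.

Lemma outer_lebesgue_bigcup_le (R : realType) (A : nat -> set R) :
  (leb R (\bigcup_n A n) <= \sum_(n <oo) leb R (A n))%E.
Proof. exact: outer_measure_sigma_subadditive. Qed.

Lemma affine_image_itvoc (R : realType) (a l u v : R) : 0 < l ->
  affine a l @` `]u, v] = `](a + l * u), (a + l * v)]%classic.
Proof.
move=> l0; apply/seteqP; split => [_ [x /= + <-]|y /=].
  by rewrite !in_itv/= ltrD2l lerD2l ltr_pM2l// ler_pM2l.
rewrite in_itv/= => uyv; exists (l^-1 * (y - a)).
  rewrite /= in_itv/= ltr_pdivlMl// ler_pdivrMl//.
  by rewrite ltrBrDl lerBlDl.
by rewrite mulVKf ?gt_eqF// addrC subrK.
Qed.

(** The images of the intervals of a cover of [A] cover the image of [A], and their lengths are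
    multiplied by [l]. Dividing by [l] first leaves the infimum over covers alone on the right, so a
    single cover can be treated at a time. *)
Lemma outer_lebesgue_affine_le (R : realType) (a l : R) (A : set R) : 0 < l ->
  (leb R (affine a l @` A) <= l%:E * leb R A)%E.
Proof.
move=> l0; rewrite -lee_pdivrMl//.
apply: le_ereal_inf_tmp => _ [B [mB AB] <-].
rewrite lee_pdivrMl// -nneseriesZl//.
apply: ereal_inf_lbound; exists (fun k => affine a l @` B k).
  split => [k|_ [x Ax <-]].
    have [[u v] _ <-] := mB k; exists (a + l * u, a + l * v) => //=.
    by rewrite affine_image_itvoc.
  by have [k _ Bkx] := AB _ Ax; exists k => //; exists x.
apply: eq_eseriesr => k _; have [[u v] _ /= <-] := mB k.
rewrite affine_image_itvoc//.
rewrite !wlength_itv/= !lte_fin ltrD2l ltr_pM2l//.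
by case: ifPn => _; rewrite ?mule0// -!EFinD -EFinM; congr EFin; ring.
Qed.

(** Caratheodory's criterion is transported: the test set [Z] is moved forward, split there by [A],
    and the two pieces are moved back. The factors [l^-1] and [l] cancel, so the one-sided scaling
    bound suffices. *)
Lemma lebesgue_measurable_affine_preimage (R : realType) (a l : R) (A : set R) :
  0 < l -> lebesgue_measurable A -> lebesgue_measurable (affine a l @^-1` A).
Proof.
move=> l0 mA; apply: le_caratheodory_measurable => Z.
have l'0 : 0 < l^-1 by rewrite invr_gt0.
have back B : Z `&` affine a l @^-1` B =
    affine (- (l^-1 * a)) l^-1 @` (affine a l @` Z `&` B).
  apply/seteqP; split => [x [Zx Bx]|_ [_ [[x Zx <-] Bx] <-]].
    exists (a + l * x); first by split => //; exists x.
    by field; rewrite gt_eqF.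
  by rewrite /= mulrDr addKr mulKf ?gt_eqF.
rewrite preimage_setC !back.
apply: le_trans (leeD (outer_lebesgue_affine_le _ _ _ _ l'0)
  (outer_lebesgue_affine_le _ _ _ _ l'0)) _.
rewrite -ge0_muleDr ?outer_measure_ge0// -(mA (affine a l @` Z)).
by rewrite lee_pdivrMl// outer_lebesgue_affine_le.
Qed.

Lemma lebesgue_measurable_itv (R : realType) (i : interval R) :
  lebesgue_measurable [set` i].
Proof. by apply: sub_caratheodory; exact: measurable_itv. Qed.

Definition half_capturing (R : realType) (I : set (set nat)) : Prop :=
  forall X : nat -> set R,
    (forall n, lebesgue_measurable (X n)) ->
    (forall n, X n `<=` `[0, 1]) ->
    ideal_pointwise_cvg I `[0, 1] (fun n => \1_(X n) : R -> R) (fun=> 0) ->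
    exists M : set R,
      [/\ lebesgue_measurable M, M `<=` `[0, 1],
          (completed_lebesgue_measure M <= (1 / 2)%:E)%E &
          I [set n | ~ (X n `<=` M)]].

Lemma indic_ideal_cvg0P (R : realType) (I : set (set nat)) (T : Type)
    (Y : set T) (X : nat -> set T) : is_ideal I ->
  ideal_pointwise_cvg I Y (fun n => \1_(X n) : T -> R) (fun=> 0) <->
  forall y, Y y -> I [set n | X n y].
Proof.
move=> hI; split=> [cX y Yy|IX y e Yy e0].
  apply: (idealS hI) (cX y 1 Yy ltr01) => n /= Xny.
  by rewrite subr0 indicE mem_set// normr1.
apply: (idealS hI) (IX y Yy) => n /=; rewrite subr0 indicE.
case: (boolP (y \in X n)) => [/set_mem//|_]; rewrite normr0.
by rewrite leNgt e0.
Qed.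

(** [J] will be an interval of a cover and may stick out of [0, 1], hence the hypothesis on every
    real [y]. *)
Lemma half_capture_itv (R : realType) (I : set (set nat)) (X : nat -> set R)
    (J : set R) : is_ideal I -> half_capturing R I ->
  (forall n, lebesgue_measurable (X n)) ->
  (forall y, I [set n | X n y]) -> ocitv J ->
  exists F, I (~` F) /\
    (leb R ((\bigcup_(n in F) X n) `&` J) <= (2^-1)%:E * wlength idfun J)%E.
Proof.
move=> hI H mX IX /ocitvP[->|[[a b] /= ab ->]].
  exists setT; split; first by apply: (ideal_finite hI); rewrite setCT.
  by rewrite setI0 outer_measure0 mule_ge0 ?wlength_ge0.
have l0 : 0 < b - a by rewrite subr_gt0.
pose phi := affine a (b - a).
have [|n x []//||M [_ _ M2 IM]] := H (fun n => `[0, 1] `&` phi @^-1` X n).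
- move=> n; apply: measurableI; first exact: lebesgue_measurable_itv.
  exact: lebesgue_measurable_affine_preimage.
- apply/indic_ideal_cvg0P => // y _.
  by apply: (idealS hI) (IX (phi y)) => n [].
(* For these [n] the part of [X n] inside [J] lies in the image of [M] under [phi], of outer measure
   at most [(b - a) / 2]. *)
exists [set n | `[0, 1] `&` phi @^-1` X n `<=` M]; split; first exact: IM.
rewrite wlength_itv/= lte_fin ab -EFinB muleC.
apply: le_trans (le_trans (outer_lebesgue_affine_le _ a _ M l0) _).
  apply: le_outer_measure => x [[n XM Xnx]]; rewrite /= in_itv/= => /andP[ax xb].
  have phiE : phi ((b - a)^-1 * (x - a)) = x.
    by rewrite /phi; field; rewrite gt_eqF.
  exists ((b - a)^-1 * (x - a)); last exact: phiE.
  apply: XM; split; last by rewrite /= phiE.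
  rewrite /= in_itv/= ler_pdivlMl// mulr0 subr_ge0 ltW//= ler_pdivrMl//.
  by rewrite mulr1 lerB.
by rewrite lee_pmul2l// -div1r.
Qed.

(** The dual filter is closed under finite intersections only; this is why just finitely many
    intervals of a cover can be halved at once. *)
Lemma ideal_setC_bigcap_ord (I : set (set nat)) (F : nat -> set nat) N :
  is_ideal I -> (forall k, I (~` F k)) -> I (~` \bigcap_(k in `I_N) F k).
Proof.
move=> hI IF; elim: N => [|N IN].
  by apply: (ideal_finite hI); rewrite II0 bigcap_set0 setCT.
apply: (idealS hI) (idealU hI IN (IF N)) => n nF.
have [Fn|] := pselect (F N n); last by right.
left=> FN; apply: nF => k /=; rewrite ltnS leq_eqVlt => /orP[/eqP->//|kN].
exact: FN.
Qed.

Lemma half_capture_shrink (R : realType) (I : set (set nat)) (X : nat -> set R)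
    (c : R) (F0 : set nat) : is_ideal I -> half_capturing R I ->
  (forall n, lebesgue_measurable (X n)) ->
  (forall y, I [set n | X n y]) -> I (~` F0) ->
  (leb R (\bigcup_(n in F0) X n) < c%:E)%E ->
  exists2 F, I (~` F) & (leb R (\bigcup_(n in F) X n) < (3 / 4 * c)%:E)%E.
Proof.
move=> hI H mX IX IF0 F0c.
have c0 : 0 < c by rewrite -lte_fin (le_lt_trans _ F0c)// outer_measure_ge0.
have [_ [J [mJ F0J] <-] Jc] := ereal_inf_lt F0c.
pose w k := wlength idfun (J k).
have w0 k : (0 <= w k)%E by exact: wlength_ge0.
have [F F_] := choice (fun k => half_capture_itv _ _ _ _ hI H mX IX (mJ k)).
have IF k : I (~` F k) by have [] := F_ k.
have tail0 := nneseries_tail_cvg (lt_trans Jc (ltry c)) (fun k _ => w0 k).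
have [N tailN] : exists N, (\sum_(N <= k <oo) w k < (c / 4)%:E)%E.
  move/fine_cvgP: tail0 => [fint /cvgr_lt tail_lt].
  near \oo => N; exists N; rewrite -[ltLHS]fineK; last by near: N.
  by rewrite lte_fin; near: N; apply: tail_lt; rewrite divr_gt0.
exists (F0 `&` \bigcap_(k in `I_N) F k).
  rewrite setCI; apply: (idealU hI) => //; exact: ideal_setC_bigcap_ord.
(* The halved intervals contribute at most [c / 2] and the untouched tail less than [c / 4], which
   gives the factor 3/4. *)
pose B k := if (k < N)%N then (\bigcup_(n in F k) X n) `&` J k else J k.
apply: (@le_lt_trans _ _ (leb R (\bigcup_k B k))).
  apply: le_outer_measure => x [n [F0n Fn] Xnx].
  have [k _ Jkx] := F0J x (ex_intro2 _ _ n F0n Xnx).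
  exists k => //; rewrite /B; case: ifPn => // kN.
  by split => //; exists n => //; exact: Fn.
apply: le_lt_trans (outer_lebesgue_bigcup_le _ _) _.
rewrite (nneseries_split _ N); last by move=> k _; exact: outer_lebesgue_ge0.
rewrite add0n.
apply: (@le_lt_trans _ _
    ((2^-1)%:E * \sum_(0 <= k < N) w k + \sum_(N <= k <oo) w k)%E).
  apply: leeD.
    rewrite ge0_sume_distrr// !big_nat; apply: lee_sum => k /andP[_ kN].
    by rewrite /B kN; have [] := F_ k.
  apply: lee_nneseries => [k _ _|k _]; first exact: outer_lebesgue_ge0.
  rewrite /w -(measurable_mu_extE _ (mJ k)); apply: le_outer_measure.
  by rewrite /B => x; case: ifPn => // _ [].
have sumN : (\sum_(0 <= k < N) w k <= c%:E)%E.
  by apply: le_trans (ltW Jc); apply: nneseries_lim_ge.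
rewrite (_ : 3 / 4 * c = 2^-1 * c + c / 4); last by field.
rewrite EFinD EFinM lee_ltD//.
(* Strictness comes from the tail alone, so the other summand has to be finite. *)
- rewrite ge0_fin_numE ?mule_ge0 ?sume_ge0//.
  by rewrite (le_lt_trans _ (ltry (2^-1 * c)))// EFinM lee_pmul2l.
- by rewrite lee_pmul2l.
Unshelve. all: by end_near. Qed.

Lemma half_capture_small (R : realType) (I : set (set nat)) (X : nat -> set R)
    (delta : R) : is_ideal I -> half_capturing R I ->
  (forall n, lebesgue_measurable (X n)) ->
  (forall n, X n `<=` `[0, 1]) ->
  (forall y, I [set n | X n y]) -> 0 < delta ->
  exists F, I (~` F) /\ (leb R (\bigcup_(n in F) X n) <= delta%:E)%E.
Proof.
move=> hI H mX X01 IX d0.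
have shrink k : exists2 F, I (~` F) &
    (leb R (\bigcup_(n in F) X n) < (3 * (3 / 4) ^+ k)%:E)%E.
  elim: k => [|k [F IF Fk]].
    (* The interval is left-open, so it starts at -1 in order to contain 0; its length 2 is strictly
       below the initial bound 3. *)
    exists setT; first by apply: (ideal_finite hI); rewrite setCT.
    apply: (@le_lt_trans _ _ (leb R `]-1, 1])).
      apply: le_outer_measure => x [n _ /X01].
      rewrite /= !in_itv/= => /andP[x0 ->].
      by rewrite andbT (lt_le_trans _ x0)// ltrN10.
    rewrite measurable_mu_extE/=; last exact: is_ocitv.
    by rewrite wlength_itv_bnd ?lte_fin/= ?expr0; lra.
  have [G IG Gk] := half_capture_shrink _ _ _ _ _ hI H mX IX IF Fk.
  by exists G => //; rewrite exprS mulrCA.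
have [k kd] : exists k, 3 * (3 / 4) ^+ k < delta.
  have z1 : `|3 / 4 : R| < 1 by rewrite ger0_norm; lra.
  have := cvg_geometric 3 z1 => /cvgr_lt /(_ _ d0) lt_d.
  by near \oo => k; exists k; near: k.
have [F IF Fk] := shrink k; exists F; split => //.
by rewrite ltW// (lt_trans Fk).
Unshelve. all: by end_near. Qed.

Lemma half_capturing_egorov (R : realType) (I : set (set nat)) :
  is_ideal I -> half_capturing R I -> egorov_ideal R I.
Proof.
move=> hI H f_ f mf_ mf cf eta eta0.
(* These bounds sum to at most [eta / 2]; the spare factor 2 yields the strict inequality in the
   Egorov property. *)
have d0 k : 0 < eta / 2 / (2 ^ k.+1)%:R.
  by rewrite !divr_gt0// ltr0n expn_gt0.
pose A k n : set R := `[0, 1] `&` [set y | k.+1%:R^-1 <= `|f_ n y - f y|].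
have mA k n : lebesgue_measurable (A k n).
  have mg : lebesgue_measurable_fun `[0, 1] (fun y => `|f_ n y - f y|).
    exact: (measurableT_comp (@normr_measurable R setT)
      (measurable_funB (mf_ n) mf)).
  rewrite /A (_ : [set y | _] =
      (fun y => `|f_ n y - f y|) @^-1` `[k.+1%:R^-1, +oo[).
    by apply: mg; [exact: lebesgue_measurable_itv|exact: measurable_itv].
  by apply/seteqP; split => y /=; rewrite in_itv/= andbT.
have IA k y : I [set n | A k n y].
  have [y01|y01] := pselect (`[0, 1]%classic y); last first.
    by apply: (idealS hI) (ideal_finite hI (finite_set0 _)) => n [].
  have k0 : 0 < k.+1%:R^-1 :> R by rewrite invr_gt0.
  by apply: (idealS hI) (cf y k.+1%:R^-1 y01 k0) => n [].
have [F F_] := choice (fun k => half_capture_small _ _ _ _ hI H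
  (mA k) (fun n => @subIsetl _ _ _) (IA k) (d0 k)).
pose V := \bigcup_k \bigcup_(n in F k) A k n.
have mV : lebesgue_measurable V.
  apply: bigcupT_measurable => k; apply: bigcup_measurable => n _; exact: mA.
exists (`[0, 1] `\` V); split.
- by apply: measurableD => //; exact: lebesgue_measurable_itv.
- exact: subIsetl.
(* [completed_lebesgue_measure] unfolds to the outer measure, so monotonicity and subadditivity of
   the latter apply. *)
- apply: (@le_lt_trans _ _ (leb R V)).
    by apply: le_outer_measure => x [x01 /not_andP[]// /contrapT].
  apply: le_lt_trans (outer_lebesgue_bigcup_le _ _) _.
  apply: (@le_lt_trans _ _ (eta / 2)%:E); last first.
    by rewrite lte_fin ltr_pdivrMr// ltr_pMr// ltr1n.
  apply: le_trans (epsilon_trick0 xpredT _); last by rewrite divr_ge0 ?ltW.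
  apply: lee_nneseries => [k _ _|k _]; first exact: outer_lebesgue_ge0.
  by have [] := F_ k.
- move=> e e0; near \oo => k.
  have ke : k.+1%:R^-1 <= e.
    by rewrite ltW//; near: k; exact: near_infty_natSinv_lt (PosNum e0).
  (* For [n] in [F k], every point where the error is at least [e] lies in [A k n], hence in [V]; so
     the bad indices avoid [F k]. *)
  apply: (idealS hI) (F_ k).1 => n [y [y01 Vy] ey] Fkn; apply: Vy.
  by exists k => //; exists n => //; split => //=; exact: le_trans ey.
Unshelve. all: by end_near. Qed.

(** For [eta = 1/2] the complement of the Egorov set captures: at a point of [X n] inside [M] the
    indicator is at distance 1 from 0, so uniform convergence is tested at 1. *)
Lemma egorov_half_capturing (R : realType) (I : set (set nat)) :
  is_ideal I -> egorov_ideal R I -> half_capturing R I.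
Proof.
move=> hI E X mX X01 cX.
have [n|||M [mM M01 M2 uM]] := E (fun n => \1_(X n)) (fun=> 0) _ _ cX 2^-1.
- exact: (@measurable_indic _ (lebesgueType R) R `[0, 1]%classic (X n) (mX n)).
- exact: measurable_cst.
- by [].
exists (`[0, 1] `\` M); split.
- by apply: measurableD => //; exact: lebesgue_measurable_itv.
- exact: subIsetl.
- by rewrite div1r ltW.
- apply: (idealS hI) (uM 1 ltr01) => n /= XnM.
  apply: contrapT => nM; apply: XnM => x Xnx; split; first exact: (X01 n).
  move=> Mx; apply: nM; exists x => //.
  by rewrite subr0 indicE mem_set// normr1.
Qed.

Theorem theorem3p4 (R : realType) (I : set (set nat)) (hI : is_ideal I) :
  egorov_ideal R I <->
  forall X : nat -> set R,
    (forall n, lebesgue_measurable (X n)) ->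
    (forall n, X n `<=` `[0, 1]) ->
    ideal_pointwise_cvg I `[0, 1] (fun n => \1_(X n) : R -> R) (fun=> 0) ->
    exists M : set R,
      [/\ lebesgue_measurable M, M `<=` `[0, 1],
          (completed_lebesgue_measure M <= (1 / 2)%:E)%E &
          I [set n | ~ (X n `<=` M)]].
Proof.
by split; [exact: egorov_half_capturing|exact: half_capturing_egorov].
Qed.
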